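(* There exists a constant $0<\alpha\le 1$ such that for every $\Delta$ and every graph $G=(V,E)$ with maximum degree at most $\Delta$, there is a partition $(A,B)$ of $V$ such that $tw(G[A])\ge \left\lfloor\frac{\alpha\,tw(G)}{\Delta^2}\right\rfloor$ and $tw(G[B])\ge \left\lfloor\frac{\alpha\,tw(G)}{\Delta^2}\right\rfloor$.
   Context: Graphs are undirected, without self-loops, possibly with parallel edges. $tw$ denotes treewidth and $G[A]$ the subgraph induced by the vertex set $A$. *)

(* Defs.v *)
From mathcomp Require Import all_boot all_order all_algebra.
From mathcomp Require Import boolp reals.

Set Implicit Arguments.
Unset Strict Implicit.
Unset Printing Implicit Defensive.

(* Finite undirected multigraphs: [card_ends] excludes loops, while [ends] need
   not be injective, so parallel edges are allowed. *)
Record mgraph : Type := MGraph {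
  vertex : finType;
  edge : finType;
  ends : edge -> {set vertex};
  card_ends : forall e : edge, #|ends e| = 2
}.

Definition degree (G : mgraph) (v : vertex G) : nat :=
  #|[set e : edge G | v \in ends e]|.

Definition max_degree (G : mgraph) : nat := \max_(v : vertex G) degree v.

Section Induced.
Variables (G : mgraph) (A : {set vertex G}).

Definition induced_vertex : finType := {v : vertex G | v \in A}.
Definition induced_edge : finType := {e : edge G | ends e \subset A}.
Definition induced_ends (e : induced_edge) : {set induced_vertex} :=
  [set v | val v \in ends (val e)].

Lemma card_induced_ends (e : induced_edge) : #|induced_ends e| = 2.
Proof.
rewrite -(card_ends (val e)) -(card_imset _ val_inj).
apply: eq_card => x; apply/imsetP/idP => [[y + ->]|xe]; first by rewrite inE.
have xA : x \in A by apply: subsetP xe; exact: (valP e).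
by exists (exist _ x xA : induced_vertex); rewrite ?inE.
Qed.

Definition induced : mgraph := MGraph card_induced_ends.

End Induced.

Record is_tree (T : finType) (r : rel T) : Prop := IsTree {
  tree_nonempty : 0 < #|T|;
  tree_sym : symmetric r;
  tree_irr : irreflexive r;
  tree_connected : forall s t : T, connect r s t;
  (* a 2-element [ucycle] of a symmetric relation just traverses one edge back
     and forth *)
  tree_acyclic : forall c : seq T, ucycle r c -> size c <= 2
}.

Record is_tree_decomposition (G : mgraph) (T : finType) (r : rel T)
    (bag : T -> {set vertex G}) : Prop := IsTreeDecomposition {
  td_tree : is_tree r;
  td_vertex : forall v : vertex G, exists t : T, v \in bag t;
  td_edge : forall e : edge G, exists t : T, ends e \subset bag t;
  td_connected : forall (v : vertex G) (s t : T),
    v \in bag s -> v \in bag t ->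
    connect [rel x y | [&& r x y, v \in bag x & v \in bag y]] s t
}.

(* The predecessor is truncated, so the graph without vertices has width 0
   rather than -1. *)
Definition width (V T : finType) (bag : T -> {set V}) : nat :=
  (\max_(t : T) #|bag t|).-1.

Definition has_td_of_width (G : mgraph) (k : nat) : Prop :=
  exists (T : finType) (r : rel T) (bag : T -> {set vertex G}),
    is_tree_decomposition r bag /\ width bag = k.

Lemma has_td_of_some_width (G : mgraph) :
  exists k : nat, `[< has_td_of_width G k >].
Proof.
pose bag (_ : unit) := [set: vertex G].
exists (width bag); apply/asboolP.
exists unit, (fun _ _ => false), bag; split=> //; split.
- split=> //; first by rewrite card_unit.
  + by move=> [] []; apply: connect0.
  + by case=> [|x [|y c]] //= /andP[].
- by move=> v; exists tt; rewrite inE.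
- by move=> e; exists tt; apply: subsetT.
- by move=> v [] [] _ _; apply: connect0.
Qed.

Definition treewidth (G : mgraph) : nat := ex_minn (has_td_of_some_width G).

(* Main.v *)
Require Import Defs.
From mathcomp Require Import all_boot all_order all_algebra.
From mathcomp Require Import boolp reals.
From mathcomp Require Import zify.

(* Fix [w] and suppose that for every vertex set [X], one of [G[X]] and
   [G - X] has treewidth less than [w] (is narrow).  Growing a narrow set until
   it stops being narrow partitions the vertices into three narrow sets [X],
   [Y], [Z].  Adding one end of each edge between the parts to all bags of
   their decompositions shows that at least [tw(G) - w] edges cross, say a
   third of them between [X] and [Y].  Balanced separators cut [X] into [A1],
   [A2] and [Y] into [B1], [B2], losing at most [2 w D] edges, where [D] is the
   maximum degree, so that (up to exchanging [B1] and [B2]) more edges than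
   that join [A1] to [B1] and [A2] to [B2].  Adding the five pieces one by one
   in the order [A1], [B1], [Z], [B2], [A2] until narrowness is lost gives
   another partition into three narrow sets, with fewer crossing edges.  This
   cannot be repeated forever. *)

Set Implicit Arguments.
Unset Strict Implicit.
Unset Printing Implicit Defensive.

(** * Cycles in finite relations, and joining two trees by an edge *)

Lemma connect_homo (S T : finType) (e : rel S) (e' : rel T) (h : S -> T) :
    (forall x y, e x y -> connect e' (h x) (h y)) ->
  forall x y, connect e x y -> connect e' (h x) (h y).
Proof.
move=> he x y /connectP[p + ->]; elim: p x => [|z p IH] x /=.
  by rewrite connect0.
by case/andP=> /he xz /IH; apply: connect_trans.
Qed.

(** Iterating [next c] from [x] reaches [y], so a cycle that never leaves [P] cannot contain
    both. *)
Lemma cycle_exit (T : finType) (P : pred T) (c : seq T) (x y : T) :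
  uniq c -> x \in c -> y \in c -> P x -> ~~ P y ->
  exists2 z, z \in c & P z && ~~ P (next c z).
Proof.
move=> Uc xc yc Px; apply: contraNP => noexit.
have : fconnect (next c) x y by rewrite (fconnect_cycle (cycle_next Uc)).
move=> /iter_findex <-; elim: (findex _ _ _) => [//|n IH] /=.
apply: contra_notT noexit => NP; exists (iter n (next c) x); last exact/andP.
have := cycle_next Uc => /fconnect_cycle/(_ _ xc) <-.
exact: fconnect_iter.
Qed.

Lemma next_next_size (T : eqType) (c : seq T) (x : T) :
  uniq c -> x \in c -> next c (next c x) = x -> size c <= 2.
Proof.
move=> Uc xc; have [i c' Ec] := rot_to xc.
rewrite -(next_rot i) // -(next_rot i Uc) Ec -(size_rot i) Ec.
have: uniq (x :: c') by rewrite -Ec rot_uniq.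
case: c' {Ec} => [|y [|z c']] //=.
rewrite !inE !negb_or eqxx => /and3P[/and3P[xy xz _] /andP[yz _] _].
by rewrite eq_sym (negPf xy) eqxx => /eqP; rewrite eq_sym (negPf xz).
Qed.

Section JoinTrees.

Variables (T1 T2 : finType) (r1 : rel T1) (r2 : rel T2) (a1 : T1) (a2 : T2).

Definition join_rel : rel (T1 + T2) := fun x y =>
  match x, y with
  | inl s, inl t => r1 s t
  | inr s, inr t => r2 s t
  | inl s, inr t | inr t, inl s => (s == a1) && (t == a2)
  end.

Hypotheses (tree1 : is_tree r1) (tree2 : is_tree r2).

Lemma join_connected s t : connect join_rel s t.
Proof.
have in1 x y : connect join_rel (inl x) (inl y).
  apply: (connect_homo (e := r1) (h := inl)); last exact: (tree_connected tree1).
  by move=> u v uv; apply: connect1.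
have in2 x y : connect join_rel (inr x) (inr y).
  apply: (connect_homo (e := r2) (h := inr)); last exact: (tree_connected tree2).
  by move=> u v uv; apply: connect1.
have b12 : connect join_rel (inl a1) (inr a2).
  by apply: connect1; rewrite /= !eqxx.
have b21 : connect join_rel (inr a2) (inl a1).
  by apply: connect1; rewrite /= !eqxx.
case: s t => [s|s] [t|t] //.
  by apply: connect_trans (in1 _ _) (connect_trans b12 (in2 _ _)).
by apply: connect_trans (in2 _ _) (connect_trans b21 (in1 _ _)).
Qed.

(** A cycle inside one tree is a cycle of that tree. A cycle meeting both must leave each of them,
    and only the edge joining [a1] to [a2] allows this, so two steps of [next] lead back to the
    start. *)
Lemma join_acyclic c : ucycle join_rel c -> size c <= 2.
Proof.
case/andP=> cc Uc; pose P (x : T1 + T2) := if x is inl _ then true else false.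
have [/existsP[x /andP[xc Px]]|no1] := boolP [exists x in c, P x]; last first.
  have [c2 Ec] : exists c2, c = map inr c2.
    elim: c {cc Uc} no1 => [|x c IH] no1; first by exists [::].
    have [|c2 ->] := IH.
      apply: contra no1 => /existsP[z /andP[zc Pz]]; apply/existsP; exists z.
      by rewrite inE zc orbT.
    case: x no1 => [x /existsP[]|x _]; last by exists (x :: c2).
    by exists (inl x); rewrite mem_head.
  move: cc Uc; rewrite Ec size_map cycle_map map_inj_uniq; last by move=> ? ? [].
  by move=> c2c U2; apply: (tree_acyclic tree2); apply/andP.
have [/existsP[y /andP[yc Py]]|no2] := boolP [exists x in c, ~~ P x]; last first.
  have [c1 Ec] : exists c1, c = map inl c1.
    elim: c {x xc Px cc Uc} no2 => [|x c IH] no2; first by exists [::].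
    have [|c1 ->] := IH.
      apply: contra no2 => /existsP[z /andP[zc Pz]]; apply/existsP; exists z.
      by rewrite inE zc orbT.
    case: x no2 => [x _|x /existsP[]]; first by exists (x :: c1).
    by exists (inr x); rewrite mem_head.
  move: cc Uc; rewrite Ec size_map cycle_map map_inj_uniq; last by move=> ? ? [].
  by move=> c1c U1; apply: (tree_acyclic tree1); apply/andP.
have [u uc /andP[Pu nPu]] := cycle_exit Uc xc yc Px Py.
have [|v vc /andP[nPv Pv]] := cycle_exit (P := predC P) Uc yc xc Py.
  by rewrite /= Px.
have := next_cycle cc vc; have := next_cycle cc uc.
case: u uc Pu nPu => // s uc _; case: v vc nPv Pv => // t vc _.
case Nv: (next c (inr t)) => [t'|//] _; case Nu: (next c (inl s)) => [//|s'] _.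
move=> /= /andP[/eqP Es /eqP Es'] /andP[/eqP Et' /eqP Et].
by apply: (next_next_size Uc uc); rewrite Nu Es' -Et Nv Et' -Es.
Qed.

Lemma join_tree : is_tree join_rel.
Proof.
split.
- by rewrite card_sum addn_gt0 (tree_nonempty tree1).
- by move=> [x|x] [y|y] //=; [apply: (tree_sym tree1) | apply: (tree_sym tree2)].
- by move=> [x|x] /=; [apply: (tree_irr tree1) | apply: (tree_irr tree2)].
- exact: join_connected.
- exact: join_acyclic.
Qed.

End JoinTrees.

(** * Components of a tree minus a node *)

Section Centroid.

Variables (T : finType) (r : rel T).
Hypothesis tree : is_tree r.

(** The classes of [connect (avoid t)] are the components of the tree minus [t], and the singleton
    of [t]. *)
Definition avoid (t : T) : rel T := [rel x y | [&& r x y, x != t & y != t]].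

Lemma avoid_sym t : connect_sym (avoid t).
Proof.
by apply: sym_connect_sym => x y; rewrite /avoid /= (tree_sym tree) [_ && (y != t)]andbC.
Qed.

Lemma toward (t s : T) : s != t -> exists2 y, r t y & connect (avoid t) y s.
Proof.
move=> st; have /connectP[p pp Es] := tree_connected tree t s.
case/shortenP: pp Es => q qq Uq _ Es.
case: q qq Uq Es => [|y q] /=; first by move=> _ _ Es; rewrite Es eqxx in st.
rewrite inE negb_or => /andP[ty yq] /andP[/andP[t_y tq] Uq] Es.
exists y => //; apply/connectP; exists q => //; rewrite eq_sym in t_y.
elim: q y {ty Uq Es} t_y tq yq => //= z q IH y yt.
rewrite inE negb_or => /andP[tz tq] /andP[yz zq].
by rewrite eq_sym in tz; rewrite /avoid /= yz yt tz; apply: IH.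
Qed.

(** Otherwise the walk from [y] through [s] and [s'] to [x] would bypass the edge between [x] and
    [y], and together with it contain a cycle of at least three nodes. *)
Lemma no_bypass (x y s s' : T) :
    r x y -> connect (avoid x) y s -> connect (avoid y) s' x ->
    connect [rel u v | avoid x u v && avoid y u v] s s' -> False.
Proof.
move=> xy ys s'x ss'.
(* Forbidding the step from [y] to [x] is enough: a simple path from [y] to [x] then has an inner
   node. *)
pose e := [rel u v | r u v && ~~ ((u == y) && (v == x))].
have sub (f : rel T) : (forall u v, f u v -> r u v && ((u != y) || (v != x))) ->
    subrel (connect f) (connect e).
  by move=> fe; apply: connect_sub => u v /fe; rewrite -negb_and => uv; apply: connect1.
have /connectP[p pp Ex] : connect e y x.
  apply: connect_trans (_ : connect e y s) (connect_trans (_ : connect e s s') _).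
  - by apply: sub ys => u v /and3P[-> _ ->]; rewrite orbT.
  - by apply: sub ss' => u v /andP[/and3P[-> _ ->]]; rewrite orbT.
  - by apply: sub s'x => u v /and3P[-> ->].
case/shortenP: pp Ex => q qq Uq _ Ex.
have rq : path r y q by apply: sub_path qq => u v /andP[].
have : size (y :: q) <= 2.
  apply: (tree_acyclic tree); rewrite /ucycle Uq andbT /= rcons_path rq -Ex.
  exact: xy.
case: q qq Uq Ex {rq} => [|z [|//]] /=.
  by move=> _ _ Ex; rewrite Ex (tree_irr tree) in xy.
by rewrite andbT => /andP[_ + _] Ex; rewrite Ex !eqxx.
Qed.

(* Following the edges [t -- n t], a repeated node closes a cycle, which in a
   tree can only run back and forth along one edge. *)
Lemma back_and_forth (n : T -> T) :
  (forall t, r t (n t)) -> exists t, n (n t) = t.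
Proof.
move=> rn; have /card_gt0P[t0 _] := tree_nonempty tree.
(* A node with the smallest forward orbit lies on a cycle of [n]: the orbit of [n t] is contained in
   that of [t] and cannot be smaller. *)
have [t _ tmin] := arg_minnP (fingraph.order n) (erefl : predT t0).
have le : fingraph.order n (n t) <= fingraph.order n t.
  apply: subset_leq_card; apply/subsetP => u; rewrite !inE.
  by apply: connect_trans; apply: fconnect1.
have /(orbitPcycle 1 0) cyc : fingraph.order n (n t) = fingraph.order n t.
  by apply/eqP; rewrite eqn_leq le tmin.
have size2 : size (orbit n t) <= 2.
  apply: (tree_acyclic tree); rewrite /ucycle orbit_uniq andbT.
  by apply: sub_cycle cyc => u v /eqP <-.
have /(orbitPcycle 0 4) := cyc.
have rt := rn t; rewrite size_orbit in size2.
move: size2; case: (fingraph.order n t) (order_gt0 n t) => [//|[|[|//]]] _ _ /=.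
  by move=> nt; rewrite nt (tree_irr tree) in rt.
by exists t.
Qed.

End Centroid.

(** * Tree decompositions of induced subgraphs *)

(** The bags consist of vertices of [G] rather than of [induced X], so that decompositions for
    different [X] can be restricted and glued directly. *)
Record td_on (G : mgraph) (X : {set vertex G}) (T : finType) (r : rel T)
    (bag : T -> {set vertex G}) : Prop := TdOn {
  on_tree : is_tree r;
  on_sub : forall t, bag t \subset X;
  on_vertex : forall v, v \in X -> exists t, v \in bag t;
  on_edge : forall e : edge G, ends e \subset X -> exists t, ends e \subset bag t;
  on_connected : forall v s t, v \in bag s -> v \in bag t ->
    connect [rel x y | [&& r x y, v \in bag x & v \in bag y]] s t
}.

(* [narrow X w] holds iff the treewidth of [G[X]] is less than [w], for [w > 0]. *)
Definition narrow (G : mgraph) (X : {set vertex G}) (w : nat) : Prop :=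
  exists (T : finType) (r : rel T) (bag : T -> {set vertex G}),
    td_on X r bag /\ forall t, #|bag t| <= w.

Section Narrow.

Variable G : mgraph.
Implicit Types (X Y Z A B : {set vertex G}) (w : nat).

Lemma narrow_induced X w : treewidth (induced X) < w -> narrow X w.
Proof.
rewrite /treewidth; case: ex_minnP => k /asboolP[T [r [bag [td <-]]]] _ kw.
exists T, r, (fun t => val @: bag t); split=> [|t]; last first.
  rewrite card_imset; last exact: val_inj.
  apply: leq_trans (leq_bigmax (F := fun t => #|bag t|) t) _.
  by move: kw; rewrite /width; case: (\max_t _).
split.
- exact: (td_tree td).
- by move=> t; apply/subsetP => _ /imsetP[v _ ->]; apply: (valP v).
- move=> v vX; have [t vt] := td_vertex td (exist _ v vX : vertex (induced X)).
  by exists t; apply/imsetP; exists (exist _ v vX).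
- move=> e eX; have [t et] := td_edge td (exist _ e eX : edge (induced X)).
  exists t; apply/subsetP => v ve; have vX := subsetP eX _ ve.
  apply/imsetP; exists (exist _ v vX) => //; apply: (subsetP et).
  by rewrite /= /induced_ends inE.
- move=> _ s t /imsetP[v vs ->]; rewrite (mem_imset _ _ val_inj) => vt.
  apply: connect_sub (td_connected td vs vt) => x y /and3P[xy vx vy].
  by apply: connect1; rewrite /= xy !(mem_imset _ _ val_inj) vx vy.
Qed.

Lemma narrow_treewidth w : narrow [set: vertex G] w -> treewidth G <= w.-1.
Proof.
move=> [T [r [bag [td bw]]]].
rewrite /treewidth; case: ex_minnP => k _ /(_ (width bag)) kmin.
apply: leq_trans (kmin _) _.
  apply/asboolP; exists T, r, bag; split=> //; split.
  - exact: (on_tree td).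
  - by move=> v; apply: (on_vertex td).
  - by move=> e; apply: (on_edge td); apply: subsetT.
  - exact: (on_connected td).
have: \max_t #|bag t| <= w by apply/bigmax_leqP.
by rewrite /width; lia.
Qed.

Lemma narrow_mono X Y w : X \subset Y -> narrow Y w -> narrow X w.
Proof.
move=> XY [T [r [bag [td bw]]]]; exists T, r, (fun t => bag t :&: X).
split=> [|t]; last by apply: leq_trans (bw t); apply: subset_leq_card; apply: subsetIl.
split.
- exact: (on_tree td).
- by move=> t; apply: subsetIr.
- move=> v vX; have [t vt] := on_vertex td (subsetP XY _ vX).
  by exists t; rewrite inE vt.
- move=> e eX; have [t et] := on_edge td (subset_trans eX XY).
  by exists t; rewrite subsetI et.
- move=> v s t; rewrite !in_setI => /andP[vs vX] /andP[vt _].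
  apply: connect_sub (on_connected td vs vt) => x y /and3P[xy vx vy].
  by apply: connect1; rewrite /= xy !in_setI vx vy vX.
Qed.

Lemma narrow_card X w : #|X| <= w -> narrow X w.
Proof.
move=> Xw; exists unit, (fun _ _ => false), (fun _ => X); split=> //.
split=> [|//|v vX|e eX|v [] [] _ _]; try by [exists tt | apply: connect0].
split=> [|//|//|[] []|].
- by rewrite card_unit.
- exact: connect0.
- by case=> [|x [|y c]] //= /andP[].
Qed.

(** * Edge counts and the gluing of decompositions *)

Definition mult (x y : vertex G) : nat := #|[set e | ends e == [set x; y]]|.

(** For disjoint [X] and [Y], the number of edges between them. As a sum over pairs it is additive
    in each argument. *)
Definition ecount X Y : nat := \sum_(x in X) \sum_(y in Y) mult x y.

Lemma mult_gt0 x y : 0 < mult x y -> exists e : edge G, ends e = [set x; y].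
Proof. by case/card_gt0P => e; rewrite inE => /eqP; exists e. Qed.

Lemma ecountC X Y : ecount X Y = ecount Y X.
Proof.
rewrite /ecount exchange_big; apply: eq_bigr => y _; apply: eq_bigr => x _.
by rewrite /mult setUC.
Qed.

Lemma sum_setU (F : vertex G -> nat) X Y : [disjoint X & Y] ->
  \sum_(x in X :|: Y) F x = \sum_(x in X) F x + \sum_(x in Y) F x.
Proof.
by move=> dXY; rewrite -bigU //; apply: eq_bigl => x; rewrite !inE.
Qed.

Lemma ecountUl X Y Z : [disjoint X & Y] ->
  ecount (X :|: Y) Z = ecount X Z + ecount Y Z.
Proof. exact: sum_setU. Qed.

Lemma ecountUr X Y Z : [disjoint X & Y] ->
  ecount Z (X :|: Y) = ecount Z X + ecount Z Y.
Proof. by move=> dXY; rewrite ecountC ecountUl // !(ecountC Z). Qed.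

Lemma ecount0 X : ecount X set0 = 0.
Proof. by apply: big1 => x _; rewrite big_set0. Qed.

(** With the sums exchanged, an edge at [x] contributes at most 1 because its other end is
    determined, and any other edge contributes 0. *)
Lemma sum_mult_le_degree x Y : \sum_(y in Y) mult x y <= degree x.
Proof.
have -> : degree x = \sum_(e : edge G) (x \in ends e).
  by rewrite /degree -sum1_card big_mkcond /=; apply: eq_bigr => e _; rewrite inE; case: ifP.
under eq_bigr => y _.
  have -> : mult x y = \sum_(e : edge G) (ends e == [set x; y]).
    by rewrite /mult -sum1_card big_mkcond /=; apply: eq_bigr => e _; rewrite inE; case: ifP.
over.
rewrite exchange_big /=; apply: leq_sum => e _.
have [xe|xe] := boolP (x \in ends e); last first.
  by rewrite big1 // => y _; case: eqP xe => // ->; rewrite set21.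
rewrite big_mkcond /= (eq_bigr (fun y => (y \in Y) && (ends e == [set x; y]) : nat)); last first.
  by move=> y _; case: (y \in Y).
have [y0 /andP[yY /eqP Ee]|none] := pickP (fun y => (y \in Y) && (ends e == [set x; y])); last first.
  by rewrite big1 // => y _; rewrite none.
rewrite (bigD1 y0) //= big1 ?addn0; first by rewrite yY Ee eqxx.
move=> y yy0; case: eqP; rewrite ?andbF // => Ey.
have := card_ends e; rewrite Ee cards2; case: (eqVneq x y0) => // xy0 _.
have : y \in [set x; y0] by rewrite -Ee Ey set22.
rewrite !inE (negPf yy0) orbF => /eqP yx.
have : y0 \in [set x; y] by rewrite -Ey Ee set22.
by rewrite yx !inE eq_sym orbb (negPf xy0).
Qed.

Lemma ecount_leq X Y D : (forall v : vertex G, degree v <= D) ->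
  ecount X Y <= #|X| * D.
Proof.
move=> dD; rewrite /ecount -sum_nat_const; apply: leq_sum => x _.
exact: leq_trans (sum_mult_le_degree _ _) (dD x).
Qed.

(** Bags grow by at most [ecount X Y], since each vertex of [U] has an edge to [Y]. A crossing edge
    lies in any bag that contains its end in [Y]. A vertex of [U] occurs in every bag, and any other
    vertex only in the bags of one of the two trees. *)
Lemma narrow_glue X Y w : [disjoint X & Y] -> narrow X w -> narrow Y w ->
  narrow (X :|: Y) (w + ecount X Y).
Proof.
move=> dXY [T1 [r1 [bag1 [td1 bw1]]]] [T2 [r2 [bag2 [td2 bw2]]]].
have /card_gt0P[a1 _] := tree_nonempty (on_tree td1).
have /card_gt0P[a2 _] := tree_nonempty (on_tree td2).
(* The ends in [X] of the edges between [X] and [Y] go into every bag. *)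
pose U := [set x in X | 0 < \sum_(y in Y) mult x y].
have UX : U \subset X by apply/subsetP => x; rewrite inE => /andP[].
have cardU : #|U| <= ecount X Y.
  rewrite -sum1_card /ecount [leqRHS](big_setID U) /= (setIidPr UX).
  apply: leq_trans (leq_addr _ _).
  by apply: leq_sum => x; rewrite inE => /andP[].
pose bag (t : T1 + T2) := U :|: match t with inl s => bag1 s | inr s => bag2 s end.
have tree := join_tree a1 a2 (on_tree td1) (on_tree td2).
exists (T1 + T2)%type, (join_rel r1 r2 a1 a2), bag; split; last first.
  move=> t; apply: leq_trans (_ : _ <= #|U| + w) _; last by lia.
  by apply: leq_trans (leq_card_setU _ _) _; rewrite leq_add2l; case: t.
split=> //.
- move=> t; rewrite subUset (subset_trans UX (subsetUl _ _)) /=.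
  case: t => t; first exact: subset_trans (on_sub td1 t) (subsetUl _ _).
  exact: subset_trans (on_sub td2 t) (subsetUr _ _).
- move=> v /setUP[/(on_vertex td1)|/(on_vertex td2)] [t vt].
    by exists (inl t); rewrite !inE vt orbT.
  by exists (inr t); rewrite !inE vt orbT.
- move=> e eXY; have [|] := boolP (ends e \subset X).
    move=> /(on_edge td1)[t et]; exists (inl t).
    exact: subset_trans et (subsetUr _ _).
  case/subsetPn => y ye yX; have [|] := boolP (ends e \subset Y).
    move=> /(on_edge td2)[t et]; exists (inr t).
    exact: subset_trans et (subsetUr _ _).
  case/subsetPn => x xe xY.
  have yY : y \in Y by have := subsetP eXY _ ye; rewrite inE (negPf yX).
  have xX : x \in X by have := subsetP eXY _ xe; rewrite inE (negPf xY) orbF.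
  have xy : x != y by apply: contraNneq xY => ->.
  have Ee : ends e = [set x; y].
    apply/esym/eqP; rewrite eqEcard card_ends cards2 xy andbT.
    by apply/subsetP => z; rewrite !inE => /orP[]/eqP->.
  have [t yt] := on_vertex td2 yY; exists (inr t).
  rewrite Ee; apply/subsetP => z; rewrite !inE => /orP[]/eqP->; last by rewrite yt orbT.
  rewrite xX (bigD1 y) //= ltn_addr //; apply/card_gt0P; exists e.
  by rewrite inE Ee.
- move=> v s t; have [vU _ _|vU] := boolP (v \in U).
    apply: connect_sub (tree_connected tree s t) => x y xy.
    by apply: connect1; rewrite /= xy !in_setU vU.
  have nXY u : u \in X -> u \in Y -> False.
    by move=> uX uY; rewrite (disjointFr dXY uX) in uY.
  rewrite !in_setU (negPf vU) /=; case: s t => [s|s] [t|t] vs vt.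
  + apply: connect_homo (on_connected td1 vs vt) => x y /and3P[xy vx vy].
    by apply: connect1; rewrite /= xy !in_setU vx vy !orbT.
  + by case: (nXY v (subsetP (on_sub td1 s) _ vs) (subsetP (on_sub td2 t) _ vt)).
  + by case: (nXY v (subsetP (on_sub td1 t) _ vt) (subsetP (on_sub td2 s) _ vs)).
  + apply: connect_homo (on_connected td2 vs vt) => x y /and3P[xy vx vy].
    by apply: connect1; rewrite /= xy !in_setU vx vy !orbT.
Qed.

(** * Balanced separators *)

Section Split.

Variables (Z : {set vertex G}) (T : finType) (r : rel T).
Variables (bag : T -> {set vertex G}) (omega : vertex G -> nat).
Hypothesis td : td_on Z r bag.
Let tree := on_tree td.
Let wt (A : {set vertex G}) := \sum_(v in A) omega v.

(** The part of [Z] that [bag t] separates off on the side of [s]. *)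
Definition branch (t s : T) : {set vertex G} :=
  [set v | (v \notin bag t) &&
     [exists s', connect (avoid r t) s s' && (v \in bag s')]].

Lemma branch_sub t s : branch t s \subset Z.
Proof.
apply/subsetP => v; rewrite inE => /andP[_ /existsP[u /andP[_]]].
exact: (subsetP (on_sub td u)).
Qed.

Lemma branch_self t : branch t t = set0.
Proof.
apply/setP => v; rewrite !inE; apply/negP => /andP[vt /existsP[s /andP[]]].
case/connectP => [[|y p]] /=; first by move=> _ ->; rewrite (negPf vt).
by rewrite /avoid /= eqxx andbF.
Qed.

Lemma wt_leq A B : A \subset B -> wt A <= wt B.
Proof.
move=> AB; rewrite /wt [leqRHS](big_setID A) /= (setIidPr AB).
exact: leq_addr.
Qed.

(** Otherwise every node has a neighbour towards a branch of more than half the weight, and two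
    adjacent nodes [x], [y] point at each other. Their heavy branches are disjoint: the bags of a
    common vertex would connect the two sides while avoiding both [x] and [y]. *)
Lemma centroid : exists t, forall s, 2 * wt (branch t s) <= wt Z.
Proof.
apply: contrapT => none.
have heavy t : exists y, r t y /\ wt Z < 2 * wt (branch t y).
  have [s sheavy] : exists s, wt Z < 2 * wt (branch t s).
    apply: contrapT => light; apply: none; exists t => s.
    by rewrite leqNgt; apply/negP => ?; apply: light; exists s.
  have st : s != t.
    by apply: contraTneq sheavy => ->; rewrite branch_self /wt big_set0.
  have [y ty ys] := toward tree st; exists y; split=> //.
  suff -> : branch t y = branch t s by [].
  apply/setP => v; rewrite !inE; congr (_ && _); apply: eq_existsb => s'.
  by rewrite (same_connect (avoid_sym tree t) ys).
have {heavy} [n nheavy] := choice heavy.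
have [x nnx] := back_and_forth tree (fun t => (nheavy t).1).
have [xy hx] := nheavy x; have [_ hy] := nheavy (n x).
rewrite nnx in hy; move: (n x) xy hx hy => y xy hx hy.
have [dis|] := boolP [disjoint branch x y & branch y x].
  have: wt (branch x y :|: branch y x) <= wt Z.
    by apply: wt_leq; rewrite subUset !branch_sub.
  have -> : wt (branch x y :|: branch y x) = wt (branch x y) + wt (branch y x).
    exact: sum_setU.
  by lia.
rewrite -setI_eq0 => /set0Pn[v /setIP[]]; rewrite !inE.
move=> /andP[vx /existsP[s /andP[ys vs]]] /andP[vy /existsP[s' /andP[xs' vs']]].
apply: (no_bypass tree xy ys (s' := s')); first by rewrite avoid_sym.
apply: connect_sub (on_connected td vs vs') => a b /and3P[ab va vb].
have nin u z : v \in bag u -> v \notin bag z -> u != z.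
  by move=> vu; apply: contraNneq => <-.
by apply: connect1; rewrite /avoid /= ab !nin.
Qed.

End Split.

(** A centroid bag splits the rest of [Z] into colour classes of at most half the weight each. [A]
    is a heaviest union of classes within half the weight; its edges to the rest of [Z] all end in
    the bag. *)
Lemma balanced_split Z w D (omega : vertex G -> nat) :
    narrow Z w -> (forall v : vertex G, degree v <= D) ->
    (forall v, omega v <= D) -> 4 * (w * D) <= 3 * \sum_(v in Z) omega v ->
  exists A, [/\ A \subset Z, ecount A (Z :\: A) <= w * D,
    \sum_(v in Z) omega v <= 4 * \sum_(v in A) omega v
  & 2 * \sum_(v in A) omega v <= \sum_(v in Z) omega v].
Proof.
move=> [T [r [bag [td bw]]]] dD oD.
pose wt (A : {set vertex G}) := \sum_(v in A) omega v.
rewrite -/(wt Z) => large.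
have [t tP] := centroid omega td; rewrite -/(wt Z) in tP.
(* The default [t] is reached only by vertices in no bag, that is, outside [Z]. Off [bag t], the
   choice of [s] does not affect the root. *)
pose color v := fingraph.root (avoid r t) (odflt t [pick s | v \in bag s]).
have symt := avoid_sym (on_tree td) t.
have colorE v s : v \notin bag t -> v \in bag s -> color v = fingraph.root (avoid r t) s.
  move=> vt vs; rewrite /color; case: pickP => [s' vs'|/(_ s)]; last by rewrite vs.
  apply/eqP; rewrite root_connect //=.
  apply: connect_sub (on_connected td vs' vs) => a b /and3P[ab va vb].
  have nin u : v \in bag u -> u != t by move=> vu; apply: contraNneq vt => <-.
  by apply: connect1; rewrite /avoid /= ab !nin.
pose A (I : {set T}) := [set v in Z :\: bag t | color v \in I].
have A1 c : 2 * wt (A [set c]) <= wt Z.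
  apply: leq_trans (tP c); rewrite leq_mul2l /=; apply: wt_leq.
  apply/subsetP => v; rewrite !inE => /andP[/andP[vt vZ] /eqP vc].
  rewrite vt; apply/existsP; have [s vs] := on_vertex td vZ; exists s.
  by rewrite vs andbT -vc (colorE _ s) // symt connect_root.
have AU (I : {set T}) c : c \notin I -> wt (A (c |: I)) = wt (A I) + wt (A [set c]).
  move=> cI; rewrite /wt -sum_setU.
    by apply: eq_bigl => v; rewrite !inE -andb_orr orbC.
  rewrite -setI_eq0; apply/eqP/setP => v; rewrite !inE; apply/negP.
  case/andP=> /andP[_ vI] /andP[_ /eqP vc]; by rewrite -vc vI in cI.
have A0 : 2 * wt (A set0) <= wt Z.
  by rewrite /wt big1 // => v; rewrite !inE andbF.
have [I IP Imax] := arg_maxnP (P := fun I : {set T} => 2 * wt (A I) <= wt Z)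
  (fun I => wt (A I)) A0.
have {}Imax J : 2 * wt (A J) <= wt Z -> wt (A J) <= wt (A I) by apply: Imax.
have heavyI : wt Z <= 4 * wt (A I).
  rewrite leqNgt; apply/negP => light.
  (* If adding the class of [v] exceeds half the weight, that class alone weighs more than a quarter
     and beats [I]; if not, maximality makes its weight 0. *)
  have null v : v \in Z :\: bag t -> color v \notin I -> omega v = 0.
    move=> vZ vI; have := Imax (color v |: I); rewrite AU //.
    have := Imax [set color v] (A1 _); have := A1 (color v).
    have : omega v <= wt (A [set color v]).
      by rewrite /wt (bigD1 v) ?leq_addr // in_set vZ inE eqxx.
    by case: (leqP (2 * (wt (A I) + wt (A [set color v]))) (wt Z)); lia.
  have bag_small : wt (bag t) <= w * D.
    apply: leq_trans (_ : #|bag t| * D <= _); last by rewrite leq_mul2r bw orbT.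
    by rewrite -sum_nat_const; apply: leq_sum.
  have : wt Z = wt (bag t) + wt (A I).
    rewrite /wt (big_setID (bag t)) /= (setIidPr (on_sub td t)); congr (_ + _).
    rewrite (big_setID (A I)) /= [X in _ + X]big1 ?addn0.
      apply: eq_bigl => v; rewrite !inE.
      by case: (v \in bag t); case: (v \in Z); rewrite //= andbb.
    move=> v; rewrite in_setD => /andP[vA vZ]; apply: null => //.
    by move: vA; rewrite in_set vZ.
  lia.
exists (A I); split=> //.
  by apply/subsetP => v; rewrite !inE => /andP[/andP[]].
rewrite ecountC; apply: leq_trans (_ : ecount (bag t) (A I) <= _); last first.
  by apply: leq_trans (ecount_leq _ _ dD) _; rewrite leq_mul2r bw orbT.
rewrite /ecount (big_setID (bag t)) /= [X in _ + X]big1 ?addn0.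
  rewrite [leqRHS](big_setID (Z :\: A I)) /= setIC; exact: leq_addr.
(* An edge that avoids [bag t] lies in some other bag, so its two ends have the same colour. *)
move=> y; rewrite in_setD in_setD => /andP[yt /andP[yA yZ]].
apply: big1 => x; rewrite in_set in_setD => /andP[/andP[xt xZ] xI].
apply/eqP; rewrite -leqn0 leqNgt; apply/negP => /mult_gt0[e Ee].
have [|s es] := on_edge td (e := e).
  by rewrite Ee; apply/subsetP => z; rewrite !inE => /orP[]/eqP->.
move: yA; rewrite in_set in_setD yt yZ /=.
rewrite (colorE y s) ?(subsetP es) ?Ee ?set21 //.
by rewrite -(colorE x s) ?xI // ?(subsetP es) ?Ee ?set22.
Qed.

End Narrow.

(** * Descent on partitions into three narrow sets *)

Lemma disjoint_setU (T : finType) (A B C : {set T}) :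
  [disjoint A & C] -> [disjoint B & C] -> [disjoint A :|: B & C].
Proof. by rewrite -!setI_eq0 setIUl setU_eq0 => -> ->. Qed.

Lemma narrow_weaken (G : mgraph) (X : {set vertex G}) w w' :
  w <= w' -> narrow X w -> narrow X w'.
Proof.
move=> ww' [T [r [bag [td bw]]]]; exists T, r, bag; split=> // t.
exact: leq_trans (bw t) ww'.
Qed.

Section Descent.

Variables (G : mgraph) (D w : nat).
Hypothesis degree_leq : forall v : vertex G, degree v <= D.
Hypothesis w_gt0 : 0 < w.
Hypothesis tw_large : w + 48 * (w * D) <= treewidth G.
Hypothesis narrow_side : forall X : {set vertex G}, narrow X w \/ narrow (~: X) w.
Implicit Types X Y Z : {set vertex G}.

Record narrow_triple X Y Z : Prop := NarrowTriple {
  narrow_1 : narrow X w;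
  narrow_2 : narrow Y w;
  narrow_3 : narrow Z w;
  disjoint_12 : [disjoint X & Y];
  disjoint_13 : [disjoint X & Z];
  disjoint_23 : [disjoint Y & Z];
  triple_cover : X :|: Y :|: Z = [set: vertex G]
}.

Definition cross X Y Z : nat := ecount X Y + ecount X Z + ecount Y Z.

Lemma not_narrow_setT : ~ narrow [set: vertex G] w.
Proof. by move=> /narrow_treewidth; lia. Qed.

(** As the union of [X] and [Y] is not narrow, its complement is, and this contains [Z]. *)
Lemma narrow_triple_step X Y Z : narrow X w -> narrow Y w ->
    [disjoint X & Y] -> [disjoint X & Z] -> [disjoint Y & Z] ->
    X :|: Y :|: Z = [set: vertex G] -> ~ narrow (X :|: Y) w ->
  narrow_triple X Y Z.
Proof.
move=> nX nY dXY dXZ dYZ cov nXY; split=> //.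
case: (narrow_side (X :|: Y)) => // nC; apply: narrow_mono nC.
by rewrite -disjoints_subset disjoint_sym disjoint_setU.
Qed.

Lemma cross_large X Y Z : narrow_triple X Y Z -> 48 * (w * D) < cross X Y Z.
Proof.
case=> nX nY nZ dXY dXZ dYZ cov.
have nXY := narrow_glue dXY nX nY.
have := narrow_glue (disjoint_setU dXZ dYZ) nXY (narrow_weaken (leq_addr _ _) nZ).
by rewrite cov ecountUl // => /narrow_treewidth; rewrite /cross; lia.
Qed.

(** A largest narrow set stops being narrow when any further vertex [v] is added; it, [v] and the
    rest form the triple. *)
Lemma exists_narrow_triple : exists X Y Z, narrow_triple X Y Z.
Proof.
have n0 : `[< narrow (set0 : {set vertex G}) w >].
  by apply/asboolP/narrow_card; rewrite cards0.
have [X /asboolP nX Xmax] := arg_maxnP (P := fun X => `[< narrow X w >])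
  (fun X : {set vertex G} => #|X|) n0.
have [v vX] : exists v, v \notin X.
  apply: contrapT => all; apply: not_narrow_setT; apply: narrow_mono nX.
  by apply/subsetP => v _; apply: contrapT => /negP vX; apply: all; exists v.
exists X, [set v], (~: (X :|: [set v])).
have dXv : [disjoint X & [set v]] by rewrite disjoint_sym disjoints1.
apply: narrow_triple_step => //.
- by apply: narrow_card; rewrite cards1.
- by rewrite disjoint_sym disjoints_subset setCS subsetUl.
- by rewrite disjoint_sym disjoints_subset setCS subsetUr.
- exact: setUCr.
- move=> /asboolP /Xmax /=; rewrite setUC cardsU1 vX; lia.
Qed.

Ltac solve_disjoint :=
  repeat apply: disjoint_setU; rewrite disjoint_sym;
  repeat apply: disjoint_setU; by rewrite // disjoint_sym.

(* Whichever of the pieces [A1], [B1], [C], [B2], [A2] makes the union cease to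
   be narrow when they are added in this order, either [A1] and [B1] both come
   before it or [A2] and [B2] both come after it. *)
Lemma regroup A1 A2 B1 B2 C :
    narrow_triple (A1 :|: A2) (B1 :|: B2) C ->
    [disjoint A1 & A2] -> [disjoint B1 & B2] ->
    ecount A1 A2 + ecount B1 B2 < ecount A1 B1 ->
    ecount A1 A2 + ecount B1 B2 < ecount A2 B2 ->
  exists X Y Z, narrow_triple X Y Z /\
    cross X Y Z < cross (A1 :|: A2) (B1 :|: B2) C.
Proof.
case=> nA nB nC dAB dAC dBC cov dA dB gain1 gain2.
have sub (X Y X' Y' : {set vertex G}) :
    X \subset X' -> Y \subset Y' -> [disjoint X' & Y'] -> [disjoint X & Y].
  by move=> XX' YY' d; apply: disjointWl XX' (disjointWr YY' d).
have [sA1 sA2] := (subsetUl A1 A2, subsetUr A1 A2).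
have [sB1 sB2] := (subsetUl B1 B2, subsetUr B1 B2).
have d11 : [disjoint A1 & B1] by apply: sub dAB.
have d12 : [disjoint A1 & B2] by apply: sub dAB.
have d21 : [disjoint A2 & B1] by apply: sub dAB.
have d22 : [disjoint A2 & B2] by apply: sub dAB.
have d1C : [disjoint A1 & C] by apply: sub dAC.
have d2C : [disjoint A2 & C] by apply: sub dAC.
have d1C' : [disjoint B1 & C] by apply: sub dBC.
have d2C' : [disjoint B2 & C] by apply: sub dBC.
have nA1 := narrow_mono sA1 nA; have nA2 := narrow_mono sA2 nA.
have nB1 := narrow_mono sB1 nB; have nB2 := narrow_mono sB2 nB.
(* These equations let [lia] identify the counts taken in either order. *)
have [[[C1 C2] C3] C4] := (ecountC B1 A2, ecountC B1 B2, ecountC A1 A2, ecountC C B1).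
have [[[C5 C6] C7] C8] := (ecountC C B2, ecountC C A1, ecountC C A2, ecountC B2 A2).
have C9 := ecountC B1 A1.
(* Only edges within the former parts, from [A1] to [A2] or from [B1] to [B2], can start to cross.
   Those between [A2] and [B2] stop crossing in the first two cases, those between [A1] and [B1] in
   the last three. *)
have [n1|n1] := pselect (narrow (A1 :|: B1) w); last first.
  exists A1, B1, (C :|: (A2 :|: B2)); split.
    apply: narrow_triple_step n1 => //; try solve_disjoint.
    rewrite -cov; apply/setP => x; rewrite !inE.
    by do 5!case: (x \in _).
  by rewrite /cross !(ecountUl, ecountUr); try solve_disjoint;
    clear -gain1 gain2 C1 C2 C3 C4 C5 C6 C7 C8 C9; lia.
have [n2|n2] := pselect (narrow (A1 :|: B1 :|: C) w); last first.
  exists (A1 :|: B1), C, (A2 :|: B2); split.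
    apply: narrow_triple_step n2 => //; try solve_disjoint.
    rewrite -cov; apply/setP => x; rewrite !inE.
    by do 5!case: (x \in _).
  by rewrite /cross !(ecountUl, ecountUr); try solve_disjoint;
    clear -gain1 gain2 C1 C2 C3 C4 C5 C6 C7 C8 C9; lia.
have [n3|n3] := pselect (narrow (A1 :|: B1 :|: C :|: B2) w); last first.
  exists (A1 :|: B1 :|: C), B2, A2; split.
    apply: narrow_triple_step n3 => //; try solve_disjoint.
    rewrite -cov; apply/setP => x; rewrite !inE.
    by do 5!case: (x \in _).
  by rewrite /cross !(ecountUl, ecountUr); try solve_disjoint;
    clear -gain1 gain2 C1 C2 C3 C4 C5 C6 C7 C8 C9; lia.
(* All unions before [A2] are narrow, so two parts suffice and the third is empty. *)
exists (A1 :|: B1 :|: C :|: B2), A2, set0; split.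
  split=> //; try solve_disjoint.
  - by apply: narrow_card; rewrite cards0.
  - by rewrite disjoint_sym disjoints_subset sub0set.
  - by rewrite disjoint_sym disjoints_subset sub0set.
  - rewrite -cov; apply/setP => x; rewrite !inE.
    by do 5!case: (x \in _).
by rewrite /cross !ecount0 !(ecountUl, ecountUr); try solve_disjoint;
    clear -gain1 gain2 C1 C2 C3 C4 C5 C6 C7 C8 C9; lia.
Qed.

(** Here [ecount X Y] exceeds [16 * (w * D)], so each half of [X] or [Y] carries more than
    [4 * (w * D)] of these edges, while the two cuts cost at most [2 * (w * D)]. This is where 48,
    three times 16, comes from. *)
Lemma descent_heavy X Y Z :
    narrow_triple X Y Z -> cross X Y Z <= 3 * ecount X Y ->
  exists X' Y' Z', narrow_triple X' Y' Z' /\ cross X' Y' Z' < cross X Y Z.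
Proof.
move=> tr heavy; have large := cross_large tr.
have weight_leq (A : {set vertex G}) v : \sum_(y in A) mult v y <= D.
  exact: leq_trans (sum_mult_le_degree _ _) (degree_leq v).
(* A vertex of [X] is weighted by its number of edges to [Y], and conversely below. *)
have [|A [AX cutA lowA highA]] := balanced_split (narrow_1 tr) degree_leq (weight_leq Y).
  by rewrite -/(ecount X Y); lia.
have [|B [BY cutB lowB highB]] := balanced_split (narrow_2 tr) degree_leq (weight_leq X).
  by rewrite -/(ecount Y X) ecountC; lia.
rewrite -?/(ecount _ _) in lowA highA lowB highB.
rewrite ![ecount _ X]ecountC in lowB highB.
have dD (U V : {set vertex G}) : [disjoint U & V :\: U].
  by rewrite disjoint_sym disjoints_subset setDE subsetIr.
have XE : X = A :|: X :\: A by rewrite -{1}(setID X A) (setIidPr AX).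
have YE : Y = B :|: Y :\: B by rewrite -{1}(setID Y B) (setIidPr BY).
move: cutA cutB lowA highA lowB highB tr heavy large.
move: (dD A X) (dD B Y); move: (X :\: A) (Y :\: B) XE YE => A' B' -> -> dA dB.
move=> cutA cutB.
rewrite !(ecountUl, ecountUr) // => lowA highA lowB highB tr heavy large.
have [gain|gain] := ltnP (2 * (w * D)) (minn (ecount A B) (ecount A' B')).
  by apply: regroup => //; lia.
(* One of the diagonal counts is at most [2 * (w * D)], so both [ecount A B'] and [ecount A' B]
   exceed that bound; exchange [B] and [B']. *)
have UB := setUC B B'; rewrite UB in tr *.
apply: regroup => //; first by rewrite disjoint_sym.
  by rewrite (ecountC B'); clear -cutA cutB lowA lowB highA highB heavy large gain; lia.
by rewrite (ecountC B'); clear -cutA cutB lowA lowB highA highB heavy large gain; lia.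
Qed.

Lemma descent X Y Z : narrow_triple X Y Z ->
  exists X' Y' Z', narrow_triple X' Y' Z' /\ cross X' Y' Z' < cross X Y Z.
Proof.
move=> tr.
have trYZX : narrow_triple Y Z X.
  case: tr => nX nY nZ dXY dXZ dYZ cov.
  split; rewrite // 1?disjoint_sym //.
  by rewrite -cov setUC setUA.
have trXZY : narrow_triple X Z Y.
  case: tr => nX nY nZ dXY dXZ dYZ cov.
  split; rewrite // 1?disjoint_sym //.
  by rewrite -cov setUAC.
have c1 : cross Y Z X = cross X Y Z by rewrite /cross !(ecountC _ X); lia.
have c2 : cross X Z Y = cross X Y Z by rewrite /cross (ecountC Z); lia.
have [heavy|h1] := leqP (cross X Y Z) (3 * ecount X Y).
  exact: descent_heavy.
have [heavy|h2] := leqP (cross X Z Y) (3 * ecount X Z).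
  by rewrite -c2; apply: descent_heavy.
by rewrite -c1; apply: descent_heavy => //; rewrite /cross in c1 c2 h1 h2 *; lia.
Qed.

Lemma narrow_side_absurd : False.
Proof.
have [X [Y [Z tr]]] := exists_narrow_triple.
elim/ltn_ind: (cross X Y Z) {-2}X {-2}Y {-2}Z (erefl (cross X Y Z)) tr.
move=> n IH {}X {}Y {}Z En /descent[X' [Y' [Z' [tr lt]]]].
by apply: (IH (cross X' Y' Z')) tr; rewrite // -En.
Qed.

End Descent.

(** * The partition, and the passage to real numbers *)

Lemma treewidth_partition (G : mgraph) (D w : nat) :
    max_degree G <= D -> 0 < w -> 0 < D -> 49 * (w * D ^ 2) <= treewidth G ->
  exists X : {set vertex G},
    w <= treewidth (induced X) /\ w <= treewidth (induced (~: X)).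
Proof.
move=> GD w0 D0 large; apply: contrapT => none.
apply: (@narrow_side_absurd G D w) => //.
- by move=> v; apply: leq_trans GD; apply: (leq_bigmax v).
(* Since [w * D ^ 2] is at least both [w] and [w * D], the 49 splits as 1 + 48. *)
- by apply: leq_trans large; nia.
- move=> X; have [wX|/narrow_induced] := leqP w (treewidth (induced X)); last by left.
  have [wX'|/narrow_induced] := leqP w (treewidth (induced (~: X))); last by right.
  by case: none; exists X.
Qed.

Import Order.TTheory GRing.Theory Num.Theory.
Local Open Scope ring_scope.

Theorem theorem4 (R : realType) :
  exists alpha : R, 0 < alpha <= 1 /\
    forall (Delta : nat) (G : mgraph), (max_degree G <= Delta)%N ->
      exists A B : {set vertex G},
        [/\ A :|: B = [set: vertex G],
            A :&: B = set0,
            Num.floor (alpha * (treewidth G)%:R / Delta%:R ^+ 2)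
              <= (treewidth (induced A))%:Z
          & Num.floor (alpha * (treewidth G)%:R / Delta%:R ^+ 2)
              <= (treewidth (induced B))%:Z].
Proof.
exists 49%:R^-1; split.
  by rewrite invr_gt0 ltr0n invf_le1 ?ltr0n // ler1n.
move=> Delta G GD; set z := Num.floor _.
(* Treewidth is nonnegative, so any partition works when the floor is at most 0. *)
have [z0|z0] := leP z 0.
  exists setT, set0; rewrite setU0 setI0.
  by split=> //; apply: le_trans z0 _.
have [w Ez] : exists w : nat, z = w%:Z by exists `|z|%N; rewrite gez0_abs // ltW.
have wle : w%:R <= 49%:R^-1 * (treewidth G)%:R / Delta%:R ^+ 2 :> R.
  by rewrite -[w%:R]/(w%:Z%:~R) -Ez; apply: floor_le.
move: z0; rewrite {}Ez ltz_nat => w0.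
have Delta0 : (0 < Delta)%N.
  (* Division by 0 yields 0, which would force [w] to be 0. *)
  case: (posnP Delta) wle => // ->.
  by rewrite expr0n invr0 mulr0 lern0; case: w w0.
have large : (49 * (w * Delta ^ 2) <= treewidth G)%N.
  move: wle; rewrite ler_pdivlMr ?exprn_gt0 ?ltr0n //.
  rewrite [_^-1 * _]mulrC ler_pdivlMr ?ltr0n // -natrX -!natrM ler_nat.
  by rewrite mulnC.
have [X [wX wX']] := treewidth_partition GD w0 Delta0 large.
by exists X, (~: X); rewrite setUCr setICr; split.
Qed.
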